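(* For every integer $n\ge2$ and every $k=1,\dots,n-1$, $$P_n(x)=(1+x^2)^kP_{n-k}(x)+(1-x)\sum_{j=0}^{k-1}\mathcal{B}(n-j-1,0)(1+x^2)^jx^{n-j}.$$
   Context: For $0\le k\le n$ let $\mathcal{B}(n,k)=\binom{n}{\lfloor (n-k)/2\rfloor}$, so $\mathcal{B}(m,0)=\binom{m}{\lfloor m/2\rfloor}$, and let $P_n(x)=\sum_{k=0}^n\mathcal{B}(n,k)x^{n-k}$. *)

(* Defs.v *)
From mathcomp Require Import all_boot all_order all_algebra.

Set Implicit Arguments.
Unset Strict Implicit.
Unset Printing Implicit Defensive.

Import GRing.Theory.
Local Open Scope ring_scope.

(* Intended for k <= n only: the subtraction is truncated otherwise. *)
Definition calB (n k : nat) : nat := 'C(n, (n - k)./2).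

Definition P (n : nat) : {poly int} :=
  \sum_(0 <= k < n.+1) (calB n k)%:R *: 'X^(n - k).

(* Main.v *)
Require Import Defs.
From mathcomp Require Import all_boot all_order all_algebra.
From mathcomp Require Import zify ring.

Set Implicit Arguments.
Unset Strict Implicit.
Unset Printing Implicit Defensive.

Import GRing.Theory.
Local Open Scope ring_scope.

(** Reversing the sum, P_n is the truncation after x^n of the series
    sum_i C(n, floor(i/2)) x^i, and Pascal's rule says that passing from n to
    n+1 multiplies this series by 1 + x^2.  Comparing truncations gives
    P_(m+1) = (1 + x^2) P_m + (1 - x) B(m,0) x^(m+1), where the symmetry
    C(m, ceil(m/2)) = C(m, floor(m/2)) merges the two boundary terms;
    iterating this recurrence k times is the theorem. *)

(** The length [N] is independent of [n], so that truncations at different lengths can be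
    compared. *)
Definition half_binomial_sum (n N : nat) : {poly int} :=
  \sum_(0 <= i < N) 'C(n, i./2)%:R *: 'X^i.

Lemma P_half_binomial_sum n : P n = half_binomial_sum n n.+1.
Proof.
rewrite /half_binomial_sum big_nat_rev /P; apply: eq_bigr => i _.
by rewrite add0n subSS.
Qed.

Lemma half_binomial_sumS n N :
  half_binomial_sum n N.+1 =
  half_binomial_sum n N + 'C(n, N./2)%:R *: 'X^N.
Proof. by rewrite /half_binomial_sum big_nat_recr. Qed.

(** Pascal's rule applies from degree 2 on, as [i.+2./2 = i./2 + 1]; the two lowest coefficients are
    1 on both sides. *)
Lemma half_binomial_sum_pascal n N :
  half_binomial_sum n.+1 N.+2 =
  half_binomial_sum n N.+2 + 'X^2 * half_binomial_sum n N.
Proof.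
elim: N => [|N IHN].
  rewrite !half_binomial_sumS /half_binomial_sum !big_geq //.
  by rewrite mulr0 addr0 !bin0.
rewrite half_binomial_sumS IHN (half_binomial_sumS n N.+2).
rewrite (half_binomial_sumS n N) /= binS natrD scalerDl mulrDr -scalerAr.
by rewrite -exprD add2n addrACA.
Qed.

Lemma bin_uphalf n : 'C(n, uphalf n) = 'C(n, n./2).
Proof.
rewrite -(@bin_sub n n./2); last by lia.
by congr 'C(_, _); lia.
Qed.

Lemma P_rec m :
  P m.+1 = (1 + 'X^2) * P m + (1 - 'X) * ((calB m 0)%:R *: 'X^(m.+1)).
Proof.
rewrite !P_half_binomial_sum half_binomial_sum_pascal.
(* Compared with [(1 + 'X^2) * P m], the left side gains a term in ['X^(m.+1)] and lacks one in
   ['X^(m.+2)], whence the factor [1 - 'X]. *)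
rewrite 2!half_binomial_sumS -uphalfE bin_uphalf /calB subn0.
by rewrite -!mul_polyC !exprS; ring.
Qed.

Theorem theorem3p3 (n k : nat) (hn : (2 <= n)%N) (hk1 : (1 <= k)%N)
    (hkn : (k <= n - 1)%N) :
  P n = (1 + 'X^2) ^+ k * P (n - k)
        + (1 - 'X) * \sum_(0 <= j < k)
            (calB (n - j - 1) 0)%:R *: ((1 + 'X^2) ^+ j * 'X^(n - j)).
Proof.
have {hk1 hn hkn} : (k <= n)%N by lia.
elim: k => [|k IHk] lt_kn.
  by rewrite big_geq // mulr0 addr0 expr0 mul1r subn0.
rewrite big_nat_recr //= {1}IHk; last exact: ltnW.
(* The boundary term of [P_rec] at [m = n - k.+1] is the summand [j = k]. *)
have -> : (n - k = (n - k.+1).+1)%N by lia.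
by rewrite P_rec subn1 /= -!mul_polyC [(1 + _) ^+ _.+1]exprS; ring.
Qed.
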